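(* Let $C$ be the extended quaternary quadratic residue code of length $18$ and let $f\in\mathrm{Harm}_3$ be a harmonic function of degree $3$ that is invariant under $\mathrm{Aut}(C)$. Then there exists a constant $c_f$ such that $$w_{C,f}(x,y)=c_f\,\bigl(-1224x^{12}y^{6}+3672x^{10}y^{8}-14688x^{9}y^{9}+3672x^{8}y^{10}+51408x^{7}y^{11}-52632x^{6}y^{12}+7344x^{4}y^{14}+2448x^{3}y^{15}\bigr).$$
   Context: Extended quadratic residue code: for an odd prime $p$ and prime power $q$ which is a quadratic residue mod $p$, with $\alpha$ a primitive $p$-th root of unity over $\mathbb{F}_q$, the quadratic residue code is the cyclic code in $\mathbb{F}_q[x]/(x^p-1)$ generated by $\prod_{r\in(\mathbb{F}_p^\ast)^2}(x-\alpha^r)$; the extended code appends the coordinate $-\sum_{i=1}^p c_i$. Here $q=4$, $p=17$, $n=18$. $\mathrm{Aut}(C)$ is the group of coordinate permutations $\sigma\in S_n$ with $C^\sigma=C$. Harmonic functions: let $\Omega=\{1,\dots,n\}$, $X$ the set of subsets of $\Omega$, $X_k$ the $k$-subsets; $\mathbb{R}X$, $\mathbb{R}X_k$ the real vector spaces with bases $X$, $X_k$. For $f=\sum_{z\in X_k}f(z)z\in\mathbb{R}X_k$ define $\widetilde f(u)=\sum_{z\in X_k,\,z\subset u}f(z)$ for $u\in X$. The linear operator $\gamma$ is given by $\gamma(z)=\sum_{y\in X_{k-1},\,y\subset z}y$ for $z\in X_k$, and $\mathrm{Harm}_k=\ker(\gamma|_{\mathbb{R}X_k})$. $S_n$ acts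 on $\mathbb{R}X_k$ by permuting $\Omega$, and $f$ is invariant under $\mathrm{Aut}(C)$ if $f^\sigma=f$ for all $\sigma\in\mathrm{Aut}(C)$. The harmonic weight enumerator is $w_{C,f}(x,y)=\sum_{c\in C}\widetilde f(\mathrm{supp}(c))\,x^{n-\mathrm{wt}(c)}y^{\mathrm{wt}(c)}$, where $\mathrm{supp}(c)$ is the set of nonzero coordinates and $\mathrm{wt}(c)=|\mathrm{supp}(c)|$. *)

(* Defs.v *)
From HB Require Import structures.
From mathcomp Require Import all_boot all_order all_algebra all_fingroup all_field.
From mathcomp Require Import reals.
From mathcomp Require Import mpoly.

Set Implicit Arguments.
Unset Strict Implicit.
Unset Printing Implicit Defensive.

Import GRing.Theory.
Local Open Scope ring_scope.

Definition qr_poly (L : fieldType) (p : nat) (alpha : L) : {poly L} :=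
  \prod_(r : 'F_p | (r != 0) && [exists s : 'F_p, r == s ^+ 2])
     ('X - (alpha ^+ r)%:P).

(* A word c stands for the class of \sum_i c_i X^i in F[X]/(X^p - 1), and a
   ranges over the representatives of all classes, so this is the ideal
   generated by qr_poly.  The defining identity is written in L[X] because
   qr_poly is given there, but both c and a have their coefficients in F. *)
Definition qr_code (F : finFieldType) (L : fieldExtType F) (p : nat)
    (alpha : L) : {set 'rV[F]_p} :=
  [set c : 'rV[F]_p | [exists a : 'rV[F]_p,
     map_poly (in_alg L) (rVpoly c) ==
       (map_poly (in_alg L) (rVpoly a) * qr_poly p alpha) %% ('X^p - 1)]].

Definition extend_word (F : fieldType) (p : nat) (c : 'rV[F]_p) :
    'rV[F]_(p + 1) :=
  row_mx c (- \sum_i c 0 i)%:M.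

Definition extended_qr_code (F : finFieldType) (L : fieldExtType F) (p : nat)
    (alpha : L) : {set 'rV[F]_(p + 1)} :=
  [set extend_word c | c in qr_code p alpha].

Definition supp (F : fieldType) (n : nat) (c : 'rV[F]_n) : {set 'I_n} :=
  [set i | c 0 i != 0].

Definition wt (F : fieldType) (n : nat) (c : 'rV[F]_n) : nat := #|supp c|.

(* The letter in position i moves to position s i, so that
   supp (act_word s c) = s @: supp c. *)
Definition act_word (F : fieldType) (n : nat) (s : 'S_n) (c : 'rV[F]_n) :
    'rV[F]_n :=
  \row_i c 0 ((s^-1)%g i).

Definition code_Aut (F : finFieldType) (n : nat) (C : {set 'rV[F]_n}) :
    {set 'S_n} :=
  [set s : 'S_n | [set act_word s c | c in C] == C].

(* RX is the space of formal real combinations of subsets of 'I_n; the value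
   at z is the coefficient of z, and R^o makes RX a left R-module. *)
Definition RX (R : realType) (n : nat) := {ffun {set 'I_n} -> R^o}.

Definition basisX (R : realType) (n : nat) (z : {set 'I_n}) : RX R n :=
  [ffun y => (y == z)%:R].

Definition in_RXk (R : realType) (n k : nat) (f : RX R n) : Prop :=
  forall z : {set 'I_n}, #|z| != k -> f z = 0.

Definition gamma (R : realType) (n : nat) (f : RX R n) : RX R n :=
  \sum_(z : {set 'I_n}) f z *:
     \sum_(y : {set 'I_n} | (y \subset z) && (#|y|.+1 == #|z|)) basisX R y.

Definition Harm (R : realType) (n k : nat) (f : RX R n) : Prop :=
  in_RXk k f /\ gamma f = 0.

Definition act_RX (R : realType) (n : nat) (s : 'S_n) (f : RX R n) : RX R n :=
  \sum_(z : {set 'I_n}) f z *: basisX R (s @: z).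

Definition RX_invariant (R : realType) (n : nat) (G : {set 'S_n}) (f : RX R n) :
    Prop :=
  forall s : 'S_n, s \in G -> act_RX s f = f.

Definition tilde (R : realType) (n k : nat) (f : RX R n) (u : {set 'I_n}) : R :=
  \sum_(z : {set 'I_n} | (#|z| == k) && (z \subset u)) f z.

Definition varx (R : realType) : {mpoly R[2]} := 'X_ord0.
Definition vary (R : realType) : {mpoly R[2]} := 'X_ord_max.

Definition harmonic_weight_enumerator (R : realType) (F : finFieldType)
    (n k : nat) (C : {set 'rV[F]_n}) (f : RX R n) : {mpoly R[2]} :=
  \sum_(c in C) tilde k f (supp c) *:
     (varx R ^+ (n - wt c) * vary R ^+ wt c).

(* Main.v *)
(** Over the field with two elements (X^17 - 1) / (X - 1) is a product of two
    irreducible factors of degree 8, and the roots of each of them are the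
    powers of a root with exponents in a coset of <2>, the group of squares
    modulo 17.  So the generator polynomial of the quadratic residue code is one
    of these two factors, and C has a binary generator matrix.  On the
    projective line over the field with 17 elements, the maps x + 1, 2 x and
    - 1 / x preserve C, and they have two orbits on 3-subsets, with
    representatives {0, 1, 2} and {0, 1, 3}.

    For a harmonic f of degree 3, the sum of f over the 3-subsets of u is the
    opposite of its sum over the 3-subsets of the complement of u.  Hence
    w_{C,f} = - \sum_z f(z) E(z), where E(z) is the weight enumerator of the words
    of C vanishing on z.  As E is constant on the two orbits and f sums to 0, this
    is a multiple of E({0, 1, 2}) - E({0, 1, 3}).  Each term only involves 4^6
    words, which are enumerated. *)

Require Import Defs.
From HB Require Import structures.
From mathcomp Require Import all_boot all_order all_algebra all_fingroup all_field.
From mathcomp Require Import reals.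
From mathcomp Require Import mpoly.
From mathcomp Require Import ring lra.

Set Implicit Arguments.
Unset Strict Implicit.
Unset Printing Implicit Defensive.

Import Order.TTheory GRing.Theory Num.Theory.
Local Open Scope ring_scope.

(** * Binary generator matrices over the field with four elements *)

(** The pair [(a, b)] stands for [a + b * omega]. Addition is then bitwise exclusive or, and with
    binary generator matrices a message is encoded by such additions alone. *)
Definition K4 := (bool * bool)%type.

Definition add4 (x y : K4) : K4 := (x.1 (+) y.1, x.2 (+) y.2).

Definition zero4 : K4 := (false, false).

Definition elts4 : seq K4 :=
  [:: zero4; (true, false); (false, true); (true, true)].

(** The shorter word counts as padded with zeros; thus [[::]] is neutral and can end the recursion
    of [encode]. *)
Fixpoint addw (u v : seq K4) : seq K4 :=
  match u, v with
  | x :: u', y :: v' => add4 x y :: addw u' v'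
  | [::], _ => v
  | _, [::] => u
  end.

Definition scalew (x : K4) (r : seq bool) : seq K4 :=
  [seq if b then x else zero4 | b <- r].

Fixpoint encode (l : seq K4) (rows : seq (seq bool)) : seq K4 :=
  match l, rows with
  | x :: l', r :: rows' => addw (scalew x r) (encode l' rows')
  | _, _ => [::]
  end.

Definition liftb (r : seq bool) : seq K4 := [seq (b, false) | b <- r].

Fixpoint choices (As : seq (seq K4)) : seq (seq K4) :=
  if As is A :: As' then [seq x :: l | x <- A, l <- choices As'] else [:: [::]].

(* [encode] mapped over [choices], sharing the partial sums. *)
Fixpoint span (As : seq (seq K4)) (rows : seq (seq bool)) : seq (seq K4) :=
  match As, rows with
  | A :: As', r :: rows' =>
      [seq addw (scalew x r) w | x <- A, w <- span As' rows']
  | _, _ => [:: [::]]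
  end.

Lemma nth_addw u v j :
  nth zero4 (addw u v) j = add4 (nth zero4 u j) (nth zero4 v j).
Proof.
have add0 : left_id zero4 add4 by case=> [[] []].
have addr0 : right_id zero4 add4 by case=> [[] []].
by elim: u v j => [|x u IHu] [|y v] [|j] //=; rewrite ?nth_nil ?add0 ?addr0.
Qed.

Lemma size_addw u v : size (addw u v) = maxn (size u) (size v).
Proof.
by elim: u v => [|x u IHu] [|y v] //=; rewrite ?max0n ?maxn0 // IHu maxnSS.
Qed.

Lemma nth_scalew x r j :
  nth zero4 (scalew x r) j = if nth false r j then x else zero4.
Proof. by elim: r j => [|b r IHr] [|j] //=. Qed.

Lemma size_encode n l rows : size l = size rows -> (0 < size rows)%N ->
  all (fun r => size r == n) rows -> size (encode l rows) = n.
Proof.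
elim: l rows => [|x l IHl] [|r rows] //= [sl] _ /andP[/eqP sr srows].
rewrite size_addw size_map sr.
case: rows srows sl => [|r' rows] srows sl.
  by rewrite (size0nil sl) maxn0.
by rewrite IHl // maxnn.
Qed.

Lemma map_encode_choices As rows : size As = size rows ->
  [seq encode l rows | l <- choices As] = span As rows.
Proof.
elim: As rows => [|A As IH] [|r rows] //= [sA].
by rewrite map_allpairs -IH // allpairs_mapr.
Qed.

Lemma mem_choices As l : (l \in choices As) =
  (size l == size As) && all (fun p => p.1 \in p.2) (zip l As).
Proof.
elim: As l => [|A As IH] l /=; first by case: l.
apply/allpairsP/idP => [[[x m] /= [xA mAs ->]]|] /=.
  by move: mAs; rewrite IH xA eqSS.
case: l => [|x l] //=; rewrite eqSS => /and3P[sl xA lAs].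
by exists (x, l); split => //=; rewrite IH sl.
Qed.

Lemma uniq_choices As : all uniq As -> uniq (choices As).
Proof.
elim: As => [|A As IH] //= /andP[uA uAs].
by apply: allpairs_uniq => //; [exact: IH | move=> [? ?] [? ?] _ _ [-> ->]].
Qed.

Section OrderFour.
Variables (F : finFieldType) (hF : #|F| = 4%N).

(** The additive group has order 4, so 4 = 2 * 2 vanishes, and a field has no zero divisors. *)
Lemma two_eq0_card4 : 2%:R = 0 :> F.
Proof.
have h4 : 4%:R = 0 :> F.
  by have := (cyclic.expg_cardG (in_setT (1 : F))); rewrite cardsT hF FinRing.zmodXgE.
by apply/eqP; rewrite -(orbb (_ == _)) -mulf_eq0 -natrM h4.
Qed.

Lemma addrr_card4 (x : F) : x + x = 0.
Proof. by rewrite -mulr2n -mulr_natr two_eq0_card4 mulr0. Qed.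

Lemma oppr_card4 (x : F) : - x = x.
Proof. by apply/eqP; rewrite -subr_eq0 -opprD addrr_card4 oppr0. Qed.

Lemma exists_generator_card4 : {w : F | (w != 0) && (w != 1)}.
Proof.
case: (pickP [pred w : F | (w != 0) && (w != 1)]) => [w Pw | h]; first by exists w.
exfalso.
have sub : [set: F] \subset [set 0; 1].
  by apply/subsetP => x _; rewrite !inE; have /= := h x; do 2!case: eqP.
by have := subset_leq_card sub; rewrite cardsT hF cards2; case: (_ != _).
Qed.

Definition omega : F := sval exists_generator_card4.

Definition of4 (x : K4) : F := x.1%:R + x.2%:R * omega.

Lemma of4_add x y : of4 (add4 x y) = of4 x + of4 y.
Proof.
have xorE (a b : bool) : (a (+) b)%:R = a%:R + b%:R :> F.
  by case: a; case: b; rewrite ?addr0 ?add0r ?addrr_card4.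
by rewrite /of4 /= !xorE mulrDl addrACA.
Qed.

Lemma of4_0 : of4 zero4 = 0.
Proof. by rewrite /of4 mul0r addr0. Qed.

(** As [omega] is neither 0 nor 1, it is linearly independent of 1 over the prime field. *)
Lemma of4_eq0 x : (of4 x == 0) = (x == zero4).
Proof.
have /andP[w0 w1] := svalP exists_generator_card4.
case: x => [[] []]; rewrite /of4 /= ?mul0r ?mul1r ?addr0 ?add0r ?eqxx ?oner_eq0 //.
- by rewrite -[1]oppr_card4 addrC subr_eq0 (negbTE w1).
- by rewrite (negbTE w0).
Qed.

Lemma of4_inj : injective of4.
Proof.
move=> x y /eqP; rewrite -subr_eq0 oppr_card4 -of4_add of4_eq0.
by case: x y => [[] []] [[] []].
Qed.

Lemma of4_bij : bijective of4.
Proof.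
by apply: inj_card_bij; [exact: of4_inj | rewrite hF card_prod !card_bool].
Qed.

Definition word n (l : seq K4) : 'rV[F]_n := \row_j of4 (nth zero4 l j).

Definition bitmx m n (rows : seq (seq bool)) : 'M[F]_(m, n) :=
  \matrix_(i, j) (nth false (nth [::] rows i) j)%:R.

Lemma encodeE m n l rows : size l = m -> size rows = m ->
  word m l *m bitmx m n rows = word n (encode l rows).
Proof.
move=> sl srows; apply/rowP => j; rewrite !mxE.
under eq_bigr do rewrite !mxE.
elim: m l rows sl srows => [|m IH] [|x l] [|r rows] //= => [_ _|[sl] [sr]].
  by rewrite big_ord0 nth_nil of4_0.
rewrite big_ord_recl /= IH // nth_addw of4_add nth_scalew.
by case: (nth false r j); rewrite ?mulr1 ?mulr0 ?of4_0.
Qed.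

Lemma word_inj n : {in [pred l | size l == n] &, injective (word n)}.
Proof.
move=> l m /eqP sl /eqP sm /rowP e; apply: (@eq_from_nth _ zero4); first by rewrite sm.
move=> i; rewrite sl => lt_in.
by have := e (Ordinal lt_in); rewrite !mxE => /of4_inj.
Qed.

Lemma wordP n (b : 'rV[F]_n) : exists2 l, size l = n & b = word n l.
Proof.
have [inv K1 K2] := (of4_bij).
exists (mkseq (fun i => if insub i is Some j then inv (b 0 j) else zero4) n).
  by rewrite size_mkseq.
by apply/rowP => j; rewrite mxE nth_mkseq // valK K2.
Qed.

Lemma wt_word n l : size l = n -> wt (word n l) = count (predC1 zero4) l.
Proof.
move=> sl; rewrite /wt /supp -sum1_card -sum1_count (big_nth zero4) sl.
by rewrite big_mkord; apply: eq_bigl => i; rewrite inE mxE of4_eq0.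
Qed.

Lemma word_liftb n r : word n (liftb r) = \row_j (nth false r j)%:R.
Proof.
apply/rowP => j; rewrite !mxE; have [lt_jr|le_rj] := ltnP j (size r).
  by rewrite (nth_map false) // /of4 /= mul0r addr0.
by rewrite !nth_default ?size_map // of4_0.
Qed.

(* [coef] lists the coordinates of [r] in the basis [rows]. *)
Definition spanned coef rows r := (size coef == size rows) && (encode (liftb coef) rows == liftb r).

Lemma spanned_sub m n coef rows r : size rows = m -> spanned coef rows r ->
  (word n (liftb r) <= bitmx m n rows)%MS.
Proof.
move=> sr /andP[/eqP sc /eqP <-].
by rewrite -(@encodeE m) ?submxMl // size_map sc.
Qed.

End OrderFour.

(** * The quadratic residue codes of length 17 *)

Definition bits (s : seq nat) : seq bool := [seq n != 0%N | n <- s].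

(* The two irreducible factors of (X^17 - 1) / (X - 1) over the field with two
   elements, coefficients in increasing degree. *)
Definition generator (t : bool) : seq bool :=
  if t then bits [:: 1; 0; 0; 1; 1; 1; 0; 0; 1]
  else bits [:: 1; 1; 1; 0; 1; 0; 1; 1; 1].

(** Row [i] holds X^i times the generator polynomial, then the extension coordinate, which is 1
    because both polynomials have an odd number of terms. *)
Definition generator_rows t : seq (seq bool) :=
  [seq nseq i false ++ generator t ++ nseq (8 - i) false ++ [:: true] | i <- iota 0 9].

(* The inverse of the generator polynomial modulo X^9. *)
Definition generator_inv (t : bool) : seq bool :=
  if t then bits [:: 1; 0; 0; 1; 1; 1; 1; 0; 0]
  else bits [:: 1; 1; 0; 1; 0; 0; 1; 0; 1].

(** The reduced echelon form: the first nine columns are the identity, so the coordinates of a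
    codeword in this basis are its first nine entries. *)
Definition systematic_rows (t : bool) : seq (seq bool) :=
  if t then
    [:: bits [:: 1; 0; 0; 0; 0; 0; 0; 0; 0; 1; 0; 0; 1; 1; 1; 0; 0; 1];
        bits [:: 0; 1; 0; 0; 0; 0; 0; 0; 0; 0; 1; 0; 0; 1; 1; 1; 0; 1];
        bits [:: 0; 0; 1; 0; 0; 0; 0; 0; 0; 0; 0; 1; 0; 0; 1; 1; 1; 1];
        bits [:: 0; 0; 0; 1; 0; 0; 0; 0; 0; 1; 0; 0; 0; 1; 1; 1; 1; 0];
        bits [:: 0; 0; 0; 0; 1; 0; 0; 0; 0; 1; 1; 0; 1; 1; 0; 1; 1; 1];
        bits [:: 0; 0; 0; 0; 0; 1; 0; 0; 0; 1; 1; 1; 1; 0; 0; 0; 1; 0];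
        bits [:: 0; 0; 0; 0; 0; 0; 1; 0; 0; 1; 1; 1; 0; 0; 1; 0; 0; 1];
        bits [:: 0; 0; 0; 0; 0; 0; 0; 1; 0; 0; 1; 1; 1; 0; 0; 1; 0; 1];
        bits [:: 0; 0; 0; 0; 0; 0; 0; 0; 1; 0; 0; 1; 1; 1; 0; 0; 1; 1]]
  else
    [:: bits [:: 1; 0; 0; 0; 0; 0; 0; 0; 0; 1; 1; 1; 0; 1; 0; 1; 1; 1];
        bits [:: 0; 1; 0; 0; 0; 0; 0; 0; 0; 1; 0; 0; 1; 1; 1; 1; 0; 0];
        bits [:: 0; 0; 1; 0; 0; 0; 0; 0; 0; 0; 1; 0; 0; 1; 1; 1; 1; 0];
        bits [:: 0; 0; 0; 1; 0; 0; 0; 0; 0; 1; 1; 0; 0; 1; 1; 0; 0; 1];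
        bits [:: 0; 0; 0; 0; 1; 0; 0; 0; 0; 0; 1; 1; 0; 0; 1; 1; 0; 1];
        bits [:: 0; 0; 0; 0; 0; 1; 0; 0; 0; 0; 0; 1; 1; 0; 0; 1; 1; 1];
        bits [:: 0; 0; 0; 0; 0; 0; 1; 0; 0; 1; 1; 1; 1; 0; 0; 1; 0; 0];
        bits [:: 0; 0; 0; 0; 0; 0; 0; 1; 0; 0; 1; 1; 1; 1; 0; 0; 1; 0];
        bits [:: 0; 0; 0; 0; 0; 0; 0; 0; 1; 1; 1; 0; 1; 0; 1; 1; 1; 1]].

Definition rows_spanned (coef : nat -> seq bool) rows rows' :=
  all (fun i => spanned (coef i) rows (nth [::] rows' i)) (iota 0 (size rows')).

Section GeneratorMatrices.
Variables (F : finFieldType) (hF : #|F| = 4%N).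

Lemma rows_spanned_sub m k n coef rows rows' : size rows = m -> size rows' = k ->
  rows_spanned coef rows rows' ->
  (bitmx F k n rows' <= bitmx F m n rows)%MS.
Proof.
move=> sm sk /allP h; apply/row_subP => i.
have -> : row i (bitmx F k n rows') = word hF n (liftb (nth [::] rows' i)).
  by rewrite word_liftb; apply/rowP => j; rewrite !mxE.
by apply: (@spanned_sub _ _ _ _ (coef i)) => //; apply: h; rewrite mem_iota sk /=.
Qed.

Lemma generator_systematic t :
  (bitmx F 9 18 (generator_rows t) :=: bitmx F 9 18 (systematic_rows t))%MS.
Proof.
apply/eqmxP/andP; split.
  apply: (@rows_spanned_sub _ _ _ (fun i => take 9 (nth [::] (generator_rows t) i))).
  - by case: t.
  - by case: t.
  - by case: t; vm_compute.
(* A combination of generator rows amounts to a product u g, with g the generator polynomial and u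
   of degree at most 8. It has to agree with X^i modulo X^9, which forces u to be X^i / g modulo
   X^9. *)
apply: (@rows_spanned_sub _ _ _ (fun i => nseq i false ++ take (9 - i) (generator_inv t))).
- by case: t.
- by case: t.
- by case: t; vm_compute.
Qed.

End GeneratorMatrices.

(** * The two binary factors and the quadratic residue polynomial *)

Definition genpoly (K : nzRingType) t : {poly K} := Poly [seq (b : bool)%:R | b <- generator t].

Section QRGenerator.
Variable K : fieldType.
Hypothesis K2 : 2%:R = 0 :> K.

Lemma coef_genpoly t i : (genpoly K t)`_i = (nth false (generator t) i)%:R.
Proof.
rewrite coef_Poly; have [lt_i|le_i] := ltnP i (size (generator t)).
  by rewrite (nth_map false).
by rewrite !nth_default // size_map.
Qed.

Lemma genpolyE t : genpoly K t =
  if t then 1 + 'X^3 + 'X^4 + 'X^5 + 'X^8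
  else 1 + 'X + 'X^2 + 'X^4 + 'X^6 + 'X^7 + 'X^8.
Proof.
by case: t; rewrite /genpoly /= !cons_poly_def !(polyC0, polyC1); ring.
Qed.

Lemma size_genpoly t : size (genpoly K t) = 9%N.
Proof. by rewrite (@PolyK _ 0) ?size_map; case: t => //=; rewrite oner_neq0. Qed.

Lemma lead_coef_genpoly t : lead_coef (genpoly K t) = 1.
Proof. by rewrite lead_coefE size_genpoly coef_genpoly; case: t. Qed.

Lemma genpoly_factor :
  ('X - 1) * (genpoly K true * genpoly K false) = 'X^17 - 1.
Proof.
have X2 : 2%:R = 0 :> {poly K} by rewrite -polyC_natr K2.
(* Over the integers the product differs from X^17 - 1 by this even polynomial. *)
transitivity ('X^17 - 1 + 2%:R * ('X^13 - 'X^4) : {poly K}).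
  by rewrite !genpolyE; ring.
by rewrite X2 mul0r addr0.
Qed.

Lemma genpoly_dvd t : genpoly K t %| 'X^17 - 1.
Proof.
rewrite -genpoly_factor; case: t; first by rewrite mulrCA dvdp_mulr.
by rewrite mulrA dvdp_mull.
Qed.

(** The coefficients are 0 or 1, so the Frobenius map fixes them and g(x^2) = g(x)^2. *)
Lemma genpoly_root_sqr t x : root (genpoly K t) x -> root (genpoly K t) (x ^+ 2).
Proof.
have ch : 2%N \in [pchar K] by rewrite inE /= K2 eqxx.
have -> : root (genpoly K t) (x ^+ 2) = (pFrobenius_aut ch (genpoly K t).[x] == 0).
  rewrite /root; congr (_ == 0); rewrite -horner_map /= pFrobenius_autE; congr _.[_].
  apply/polyP => i; rewrite coef_map /= !coef_genpoly.
  by case: (nth _ _ _); rewrite ?rmorph1 ?rmorph0.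
by move=> /eqP ->; rewrite rmorph0.
Qed.

Lemma square_residues17 (r : 'F_17) :
  (r != 0) && [exists s : 'F_17, r == s ^+ 2] =
  ((r : nat) \in [:: 1; 2; 4; 8; 16; 15; 13; 9]%N).
Proof.
apply/andP/idP => [[r0 /existsP[s /eqP e]]|].
  move: r0; rewrite {}e; case: s => [m].
  by do 17?[case: m => [|m] //].
have sq (k : nat) : (k * k %% 17)%N = r -> r != 0 :> nat -> r != 0 /\ [exists s : 'F_17, r == s ^+ 2].
  move=> e r0; split; first by [].
  apply/existsP; exists (inZp k); apply/eqP/val_inj.
  by rewrite /= -e modnMml modnMmr.
rewrite !inE => h.
(* The candidates are square roots modulo 17 of 1, 2, 4, 8, 16, 15, 13, 9, in this order. *)
have {h} : has (fun k => (k * k %% 17)%N == r) [:: 1; 6; 2; 5; 4; 7; 8; 3]%N && (r != 0 :> nat).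
  by case/or4P: h => [/eqP->|/eqP->|/eqP->|] //; case/or4P => [/eqP->|/eqP->|/eqP->|] //; case/orP => [/eqP->|/eqP->].
by case/andP => /hasP[k _ /eqP e] r0; apply: (sq k).
Qed.

(** Since [alpha] differs from 1, it is a root of one of the two factors. Repeated squaring then
    yields eight distinct roots of this monic polynomial of degree 8, with the squares modulo 17 as
    exponents. *)
Lemma qr_poly_genpoly (alpha : K) : 17.-primitive_root alpha ->
  exists t, qr_poly 17 alpha = genpoly K t.
Proof.
move=> ha.
have [t rt] : exists t, root (genpoly K t) alpha.
  have a1 : (alpha == 1) = false.
    by rewrite -[alpha]expr1 -(expr0 alpha) (eq_prim_root_expr ha).
  have /eqP := congr1 (fun p => p.[alpha]) genpoly_factor.
  rewrite !hornerM !(hornerD, hornerN, hornerX, hornerC, hornerXn).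
  rewrite (prim_expr_order ha) subrr !mulf_eq0 subr_eq0 a1 /=.
  by case/orP => r; [exists true | exists false].
pose exps := [:: 1; 2; 4; 8; 16; 15; 13; 9]%N.
exists t.
have -> : qr_poly 17 alpha = \prod_(z <- [seq alpha ^+ i | i <- exps]) ('X - z%:P).
  rewrite /qr_poly big_map.
  have -> : \prod_(i <- exps) ('X - (alpha ^+ i)%:P) =
            \prod_(i <- [seq nat_of_ord r | r <- enum [pred r : 'F_17 | (r : nat) \in exps]])
               ('X - (alpha ^+ i)%:P).
    apply: perm_big; apply: uniq_perm => //.
      by rewrite map_inj_uniq ?enum_uniq //; exact: val_inj.
    move=> i; apply/idP/mapP => [iE | [r]]; last by rewrite mem_enum => ? ->.
    have lt_i : (i < 17)%N by move: i iE; apply/allP.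
    by exists (Ordinal lt_i : 'F_17); rewrite ?mem_enum.
  rewrite big_map big_enum /=; apply: eq_bigl => r.
  by rewrite square_residues17.
rewrite -[LHS]scale1r -(lead_coef_genpoly t); apply/esym/all_roots_prod_XsubC.
- by rewrite size_genpoly.
- have r2 := genpoly_root_sqr rt; have r4 := genpoly_root_sqr r2.
  have r8 := genpoly_root_sqr r4; have r16 := genpoly_root_sqr r8.
  have r15 := genpoly_root_sqr r16; have r13 := genpoly_root_sqr r15.
  have r9 := genpoly_root_sqr r13.
  (* The last three squarings produce the exponents 32, 64 and 128, which are 15, 13 and 9 modulo
     17. *)
  have red i : root (genpoly K t) (alpha ^+ i) -> root (genpoly K t) (alpha ^+ (i %% 17)).
    by rewrite (prim_expr_mod ha).
  move: r2 r4 r8 r16 r15 r13 r9; rewrite -!exprM => ? ? ? ? /red r15 /red r13 /red r9.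
  by do 8?[apply/andP; split => //].
rewrite uniq_rootsE map_inj_in_uniq // => i j iE jE /eqP.
have lt17 k : k \in exps -> (k < 17)%N by move: k; apply/allP.
by rewrite (eq_prim_root_expr ha) !modn_small ?lt17 // => /eqP.
Qed.

End QRGenerator.

(** * The extended code as a row space over F *)

Section ExtendedCode.
Variables (F : finFieldType) (hF : #|F| = 4%N) (L : fieldExtType F).
Variables (alpha : L) (t : bool).
Hypothesis qrE : qr_poly 17 alpha = genpoly L t.

Let F2 : 2%:R = 0 :> F := two_eq0_card4 hF.

Lemma map_genpoly : map_poly (in_alg L) (genpoly F t) = genpoly L t.
Proof.
apply/polyP => i; rewrite coef_map /= !coef_genpoly.
by case: (nth _ _ _); rewrite ?scale1r ?scale0r.
Qed.

(** The generator has binary coefficients, so the defining equation descends from L to F. As it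
    divides X^17 - 1, reduction modulo X^17 - 1 preserves its multiples, and a multiple of degree
    below 17 has a cofactor with nine coefficients. *)
Lemma mem_qr_code (c : 'rV[F]_17) : reflect
  (exists b : 'rV[F]_9, rVpoly c = rVpoly b * genpoly F t) (c \in qr_code 17 alpha).
Proof.
have mapX : map_poly (in_alg L) ('X^17 - 1) = 'X^17 - 1.
  by rewrite rmorphB rmorph1 /= map_polyXn.
have modE (a : 'rV[F]_17) :
    (map_poly (in_alg L) (rVpoly a) * qr_poly 17 alpha) %% ('X^17 - 1) =
    map_poly (in_alg L) ((rVpoly a * genpoly F t) %% ('X^17 - 1)).
  by rewrite map_modp mapX rmorphM /= map_genpoly qrE.
have sX : size ('X^17 - 1 : {poly F}) = 18%N by rewrite size_XnsubC.
have g0 : genpoly F t != 0 by rewrite -size_poly_eq0 size_genpoly.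
rewrite inE; apply: (iffP existsP) => [[a]|[b e]].
  rewrite modE => /eqP /map_poly_inj e.
  have : genpoly F t %| rVpoly c.
    by rewrite e -dvdp_mod ?genpoly_dvd // dvdp_mull.
  case/dvdpP => q cE; exists (poly_rV q); rewrite poly_rV_K //.
  have [->|q0] := eqVneq q 0; first by rewrite size_poly0.
  have : (size (rVpoly c) <= 17)%N by exact: size_poly.
  by rewrite cE size_mul // size_genpoly addnC /=.
have sb : (size (rVpoly b * genpoly F t)%R <= 17)%N.
  rewrite (leq_trans (size_polyMleq _ _)) // size_genpoly addnC /=.
  by rewrite (leq_add2l 8 _ 9) size_poly.
exists (poly_rV (rVpoly b)).
have bK : rVpoly (poly_rV (rVpoly b) : 'rV[F]_17) = rVpoly b.
  by rewrite poly_rV_K // (leq_trans (size_poly _ _)).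
by rewrite modE bK modp_small ?sX ?ltnS // e.
Qed.

Lemma generator_rowsE (i : 'I_9) (j : 'I_18) :
  nth false (nth [::] (generator_rows t) i) j =
  if (j < 17)%N then (if (j < i)%N then false else nth false (generator t) (j - i)) else true.
Proof.
have chk : all (fun i => all (fun j => nth false (nth [::] (generator_rows t) i) j ==
    if (j < 17)%N then (if (j < i)%N then false else nth false (generator t) (j - i)) else true)
  (iota 0 18)) (iota 0 9) by case: (t); vm_compute.
by apply/eqP; move/allP: chk => /(_ i) /[!mem_iota] /(_ (ltn_ord i)) /allP/(_ j) /[!mem_iota] /(_ (ltn_ord j)).
Qed.

Lemma extend_word_generator (c : 'rV[F]_17) (b : 'rV[F]_9) :
  rVpoly c = rVpoly b * genpoly F t ->
  extend_word c = b *m bitmx F 9 18 (generator_rows t).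
Proof.
move=> e.
have bE : rVpoly b = \sum_(i < 9) b 0 i *: 'X^i.
  rewrite [LHS]poly_def; apply: eq_bigr => i _.
  by rewrite valK.
have cE (j : 'I_17) : c 0 j = \sum_(i < 9) b 0 i * (if (j < i)%N then false else nth false (generator t) (j - i))%:R.
  rewrite -coef_rVpoly_ord e bE mulr_suml coef_sum; apply: eq_bigr => i _.
  rewrite -scalerAl coefZ coefXnM coef_genpoly.
  by case: ifP.
(* Evaluation at 1, where the generator takes the value 1: this accounts for the last column of
   ones. *)
have c1 : \sum_j c 0 j = \sum_i b 0 i.
  have := congr1 (fun p => p.[1]) e; rewrite hornerM.
  have h n (v : 'rV[F]_n) : (rVpoly v).[1] = \sum_i v 0 i.
    rewrite (horner_coef_wide _ (size_poly _ _)).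
    by apply: eq_bigr => i _; rewrite expr1n mulr1 coef_rVpoly_ord.
  rewrite !h => ->.
  suff -> : (genpoly F t).[1] = 1 by rewrite mulr1.
  have add11 (x : F) : x + 1 + 1 = x by rewrite -addrA addrr_card4 ?addr0.
  rewrite horner_Poly; case: (t) => /=;
    by rewrite !(mulr1, mul0r, addr0, add0r) !add11.
apply/rowP => j; rewrite mxE [RHS]mxE.
under [RHS]eq_bigr do rewrite !mxE generator_rowsE.
case: (splitP (j : 'I_(17 + 1))) => k jk.
  rewrite cE; apply: eq_bigr => i _.
  by have /= -> := jk; rewrite ?ltn_ord.
rewrite !mxE (ord1 k) mulr1n oppr_card4 // c1.
by apply: eq_bigr => i _; rewrite mulr1.
Qed.

Lemma extended_qr_codeE :
  extended_qr_code 17 alpha = [set c | (c <= bitmx F 9 18 (systematic_rows t))%MS].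
Proof.
apply/setP => c; rewrite inE -(generator_systematic hF t).
apply/imsetP/submxP => [[a /mem_qr_code[b e] ->]|[b ->]].
  by exists b; apply: extend_word_generator.
have e : rVpoly (poly_rV (rVpoly b * genpoly F t) : 'rV_17) = rVpoly b * genpoly F t.
  rewrite poly_rV_K // (leq_trans (size_polyMleq _ _)) // size_genpoly addnC /=.
  by rewrite (leq_add2l 8 _ 9) size_poly.
exists (poly_rV (rVpoly b * genpoly F t)); first by apply/mem_qr_code; exists b.
by rewrite (extend_word_generator e).
Qed.

End ExtendedCode.

(** * Symmetries and shortened codes *)

(* Positions 0, ..., 16 are the points of the affine line over the field with 17
   elements and position 17 is the point at infinity.  The three tables list
   the values of x |-> x + 1, x |-> 2 x and x |-> - 1 / x. *)
Definition shift_table : seq nat :=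
  [:: 1; 2; 3; 4; 5; 6; 7; 8; 9; 10; 11; 12; 13; 14; 15; 16; 0; 17]%N.

Definition double_table : seq nat :=
  [:: 0; 2; 4; 6; 8; 10; 12; 14; 16; 1; 3; 5; 7; 9; 11; 13; 15; 17]%N.

Definition inverse_table : seq nat :=
  [:: 17; 16; 8; 11; 4; 10; 14; 12; 2; 15; 5; 3; 7; 13; 6; 9; 1; 0]%N.

Definition moebius_tables := [:: shift_table; double_table; inverse_table].

Definition table_fun (tab : seq nat) (i : 'I_18) : 'I_18 := inord (nth 0%N tab i).

Lemma moebius_table_valid tab : tab \in moebius_tables ->
  [/\ size tab = 18%N, uniq tab & forall i, (nth 0%N tab i < 18)%N].
Proof.
move=> tabM.
have /and3P[/eqP s u lt] : [&& size tab == 18%N, uniq tab & all (fun i => i < 18)%N tab].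
  by move: tab tabM; apply/allP.
split=> // i; have [lt_i|le_i] := ltnP i (size tab); last by rewrite nth_default.
by move/allP: lt; apply; apply: mem_nth.
Qed.

Lemma table_fun_inj tab : tab \in moebius_tables -> injective (table_fun tab).
Proof.
move=> /moebius_table_valid[s u lt] i j /(congr1 val) /=; rewrite !inordK //.
by move=> /eqP; rewrite nth_uniq ?s // => /eqP /val_inj.
Qed.

Definition triple (p : nat * nat * nat) : {set 'I_18} :=
  [set inord p.1.1; inord p.1.2; inord p.2].

Definition table_step (tab : seq nat) (p : nat * nat * nat) : nat * nat * nat :=
  (nth 0%N tab p.1.1, nth 0%N tab p.1.2, nth 0%N tab p.2).

(* Move the first point to infinity and the second one to 0; the powers of 2
   are the squares, so the third one can then be moved to 1 or 3. *)
Definition normalize (p : nat * nat * nat) : nat * nat * nat :=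
  let p1 := if p.1.1 == 17%N then p
            else table_step inverse_table
                   (iter (17 - p.1.1) (table_step shift_table) p) in
  iter (17 - p1.1.2) (table_step shift_table) p1.

(** Doubling fixes 0 and infinity, and 2 has order 8 modulo 17, so eight iterates exhaust the orbit
    of the third point. *)
Definition normalizable p := has (fun q => q \in [:: (17, 0, 1); (17, 0, 3)]%N)
  (traject (table_step double_table) (normalize p) 8).

Lemma all_normalizable : all (fun a => all (fun b => all (fun c =>
  [|| a == b, a == c, b == c | normalizable (a, b, c)])
  (iota 0 18)) (iota 0 18)) (iota 0 18).
Proof. by vm_compute. Qed.

Section Orbits.
Variables (T : eqType) (g : {set 'I_18} -> T).
Hypothesis ginv : forall tab (z : {set 'I_18}), tab \in moebius_tables -> g (table_fun tab @: z) = g z.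

Definition in_range (p : nat * nat * nat) := [&& p.1.1 < 18, p.1.2 < 18 & p.2 < 18]%N.

Lemma invariant_table_step tab p : tab \in moebius_tables -> in_range p ->
  in_range (table_step tab p) /\ g (triple (table_step tab p)) = g (triple p).
Proof.
move=> tabM /and3P[a b c]; have [_ _ lt] := moebius_table_valid tabM.
split; first by rewrite /in_range !lt.
rewrite -[RHS](ginv _ tabM) /triple !imsetU !imset_set1 /table_fun /=.
by rewrite !inordK.
Qed.

Lemma invariant_iter_step tab n p : tab \in moebius_tables -> in_range p ->
  in_range (iter n (table_step tab) p) /\ g (triple (iter n (table_step tab) p)) = g (triple p).
Proof.
move=> tabM rp; elim: n => //= n [r e].
by have [? ->] := invariant_table_step tabM r.
Qed.

Lemma invariant_normalize k p : in_range p ->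
  g (triple (iter k (table_step double_table) (normalize p))) = g (triple p).
Proof.
move=> rp; rewrite /normalize.
set p1 := if _ then _ else _.
have [r1 <-] : in_range p1 /\ g (triple p1) = g (triple p).
  rewrite /p1; case: ifP => // _.
  have [|r <-] := @invariant_iter_step shift_table (17 - p.1.1) _ _ rp; first by [].
  by apply: invariant_table_step.
have [|r2 <-] := @invariant_iter_step shift_table (17 - p1.1.2) _ _ r1; first by [].
by have [|_ ->] := @invariant_iter_step double_table k _ _ r2.
Qed.

Lemma invariant_normalizable p : in_range p -> normalizable p ->
  g (triple p) = g (triple (17, 0, 1)%N) \/ g (triple p) = g (triple (17, 0, 3)%N).
Proof.
move=> rp /hasP[_ /trajectP[k _ ->]]; rewrite !inE -(invariant_normalize k rp).
by case/orP => /eqP ->; [left | right].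
Qed.

(** The representatives through infinity are traded for two subsets of the first nine positions,
    where a codeword in systematic form shows its message symbols. *)
Lemma invariant_two_values (z : {set 'I_18}) : #|z| = 3%N ->
  g z = g (triple (0, 1, 2)%N) \/ g z = g (triple (0, 1, 3)%N).
Proof.
have -> : g (triple (0, 1, 2)%N) = g (triple (17, 0, 1)%N).
  (* Normalizing (0, 1, 2) gives (17, 0, 9), and 2 * 9 = 1 modulo 17. *)
  by rewrite -(@invariant_normalize 1).
have -> : g (triple (0, 1, 3)%N) = g (triple (17, 0, 3)%N).
  (* Normalizing (0, 1, 3) gives (17, 0, 12), and 2^6 * 12 = 3 modulo 17. *)
  by rewrite -(@invariant_normalize 6).
move=> z3.
have [a az] : exists a, a \in z by apply/card_gt0P; rewrite z3.
have /cards2P[b [c [bc zE]]] : #|z :\ a| == 2%N.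
  by move: z3; rewrite (cardsD1 a z) az add1n => -[->].
have /setD1P[ba _] : b \in z :\ a by rewrite zE !inE eqxx.
have /setD1P[ca _] : c \in z :\ a by rewrite zE !inE eqxx orbT.
have -> : z = triple (a : nat, b : nat, c : nat).
  by rewrite /triple /= !inord_val -setUA -zE setD1K.
apply: invariant_normalizable; first by rewrite /in_range !ltn_ord.
have := all_normalizable.
move/allP => /(_ a) /[!mem_iota] /(_ (ltn_ord a)).
move/allP => /(_ b) /[!mem_iota] /(_ (ltn_ord b)).
move/allP => /(_ c) /[!mem_iota] /(_ (ltn_ord c)).
by rewrite !(inj_eq val_inj) eq_sym (negbTE ba) eq_sym (negbTE ca) (negbTE bc).
Qed.

End Orbits.

Lemma supp_act_word (F : fieldType) n (s : 'S_n) (c : 'rV[F]_n) :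
  supp (act_word s c) = s @: supp c.
Proof.
apply/setP => i; rewrite inE mxE; apply/idP/imsetP => [h | [j]].
  by exists ((s^-1)%g i); rewrite ?inE ?permKV.
by rewrite inE => h ->; rewrite permK.
Qed.

Lemma act_word_inj (F : fieldType) n (s : 'S_n) : injective (@act_word F n s).
Proof.
move=> c d /rowP e; apply/rowP => i.
by have := e (s i); rewrite !mxE permK.
Qed.

(** [index j tab] is the preimage of [j], in agreement with the inverse permutation in
    [act_word]. *)
Definition permute_rows (tab : seq nat) (rows : seq (seq bool)) :=
  [seq [seq nth false r (index j tab) | j <- iota 0 18] | r <- rows].

Section CodeSymmetry.
Variables (F : finFieldType) (hF : #|F| = 4%N) (t : bool).

Definition sys_code := [set c : 'rV[F]_18 | (c <= bitmx F 9 18 (systematic_rows t))%MS].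

Lemma act_word_sys_code tab (tabM : tab \in moebius_tables) c :
  (act_word (perm (table_fun_inj tabM)) c \in sys_code) = (c \in sys_code).
Proof.
set s := perm _.
have sub d : d \in sys_code -> act_word s d \in sys_code.
  rewrite !inE => /submxP[b ->].
  have -> : act_word s (b *m bitmx F 9 18 (systematic_rows t)) =
    b *m bitmx F 9 18 (permute_rows tab (systematic_rows t)).
    apply/rowP => j; rewrite !mxE; apply: eq_bigr => i _; rewrite !mxE.
    have [st ut lt] := moebius_table_valid tabM.
    rewrite (nth_map [::]); last by case: (t).
    rewrite (nth_map 0%N) ?size_iota // nth_iota // add0n.
    have -> : index (j : nat) tab = (s^-1)%g j; last by [].
    have {1}-> : j = s ((s^-1)%g j) :> nat by rewrite permKV.
    by rewrite permE /= inordK // index_uniq // st.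
  apply: submx_trans (submxMl _ _) _.
  apply: (@rows_spanned_sub _ hF _ _ _
            (fun i => take 9 (nth [::] (permute_rows tab (systematic_rows t)) i))).
  - by case: (t).
  - by case: (t).
  have chk : all (fun tb => rows_spanned
    (fun i => take 9 (nth [::] (permute_rows tb (systematic_rows t)) i))
    (systematic_rows t) (permute_rows tb (systematic_rows t))) moebius_tables.
    by case: (t); vm_compute.
  by move/allP: chk; apply.
(* An injective map of a finite set into itself is onto, which gives the converse implication. *)
have E : act_word s @: sys_code = sys_code.
  apply/eqP; rewrite eqEcard card_imset ?leqnn ?andbT; last exact: act_word_inj.
  by apply/subsetP => _ /imsetP[d dC ->]; apply: sub.
by rewrite -{1}E mem_imset //; exact: act_word_inj.
Qed.

(** The coordinate permutation preserves the code and the weights, and carries words vanishing on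
    [z] to words vanishing on its image, so the sum is reindexed by it. *)
Lemma shortened_sum_inv (V : nmodType) (psi : nat -> V) tab (z : {set 'I_18}) : tab \in moebius_tables ->
  \sum_(c in sys_code | [disjoint table_fun tab @: z & supp c]) psi (wt c) =
  \sum_(c in sys_code | [disjoint z & supp c]) psi (wt c).
Proof.
move=> tabM; set s := perm (table_fun_inj tabM).
rewrite (reindex_inj (@act_word_inj _ _ s)); apply: eq_big => [c | c _]; last first.
  by rewrite /wt supp_act_word card_imset //; exact: perm_inj.
rewrite act_word_sys_code supp_act_word; congr andb.
have -> : table_fun tab @: z = s @: z by apply: eq_imset => i; rewrite permE.
by apply: imset_disjoint; exact: perm_inj.
Qed.

End CodeSymmetry.

(** In systematic form, vanishing at a position below 9 means that the message symbol there is
    zero. *)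
Definition shortened_alphabets (zs : seq nat) : seq (seq K4) :=
  [seq if i \in zs then [:: zero4] else elts4 | i <- iota 0 9].

Lemma mem_shortened_choices zs l : size l = 9%N ->
  (l \in choices (shortened_alphabets zs)) =
  all (fun i => (i \in zs) ==> (nth zero4 l i == zero4)) (iota 0 9).
Proof.
move=> sl; rewrite mem_choices sl eqxx /=.
have alphE i x : (x \in if i \in zs then [:: zero4] else elts4) =
    ((i \in zs) ==> (x == zero4)).
  by case: (i \in zs); rewrite ?inE //; case: x => [[] []].
case: l sl => [|x0 [|x1 [|x2 [|x3 [|x4 [|x5 [|x6 [|x7 [|x8 [|? ?]]]]]]]]]] //= _.
by rewrite !alphE.
Qed.

Section ShortenedWeights.
Variables (F : finFieldType) (hF : #|F| = 4%N) (t : bool).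

Lemma mul_systematic (b : 'rV[F]_9) (j : 'I_18) (i : 'I_9) : j = i :> nat ->
  (b *m bitmx F 9 18 (systematic_rows t)) 0 j = b 0 i.
Proof.
move=> ji; rewrite mxE.
have G k : bitmx F 9 18 (systematic_rows t) k j = (k == i)%:R.
  rewrite mxE ji; congr (nat_of_bool _)%:R.
  have chk : all (fun k => all (fun i => nth false (nth [::] (systematic_rows t) k) i ==
     (k == i)) (iota 0 9)) (iota 0 9) by case: (t); vm_compute.
  move/allP: chk => /(_ k) /[!mem_iota] /(_ (ltn_ord k)).
  by move/allP => /(_ i) /[!mem_iota] /(_ (ltn_ord i)) /eqP.
rewrite (bigD1 i) //= G eqxx mulr1 big1 ?addr0 // => k /negbTE ki.
by rewrite G ki mulr0.
Qed.

Lemma shortened_sum (V : nmodType) (psi : nat -> V) zs :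
  all (fun i => i < 9)%N zs ->
  \sum_(c in sys_code F t | [disjoint [set i : 'I_18 | (i : nat) \in zs] & supp c]) psi (wt c) =
  \sum_(l <- span (shortened_alphabets zs) (systematic_rows t)) psi (count (predC1 zero4) l).
Proof.
move=> zs9.
have srows : size (systematic_rows t) = 9%N by case: (t).
have se l : size l = 9%N -> size (encode l (systematic_rows t)) = 18%N.
  by move=> sl; apply: size_encode; rewrite ?srows //; case: (t).
rewrite -map_encode_choices ?srows // big_map.
have sch l : l \in choices (shortened_alphabets zs) -> size l = 9%N.
  by rewrite mem_choices => /andP[/eqP->].
have -> : \sum_(l <- choices (shortened_alphabets zs))
      psi (count (predC1 zero4) (encode l (systematic_rows t))) =
    \sum_(c <- [seq word hF 9 l *m bitmx F 9 18 (systematic_rows t)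
      | l <- choices (shortened_alphabets zs)]) psi (wt c).
  rewrite big_map; apply: eq_big_seq => l /sch sl.
  by rewrite encodeE // wt_word ?se.
rewrite -big_filter; apply: perm_big; apply: uniq_perm.
- exact/filter_uniq/index_enum_uniq.
- rewrite map_inj_in_uniq ?uniq_choices //.
    by rewrite all_map; apply/allP => i _ /=; case: ifP.
  (* Encoding is injective: the first nine coordinates give the message back. *)
  move=> l m /sch sl /sch sm e; apply: (@word_inj _ hF 9); rewrite ?inE ?sl ?sm //.
  apply/rowP => i; have lt_i : (i < 18)%N by apply: leq_trans (ltn_ord i) _.
  by rewrite -!(@mul_systematic _ (Ordinal lt_i) i) // e.
move=> c; rewrite mem_filter mem_index_enum andbT; apply/andP/mapP => [[] | [l lC ->]].
  rewrite inE => /submxP[b ->] dis; have [l sl bE] := wordP hF b.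
  exists l; last by rewrite bE.
  rewrite mem_shortened_choices //; apply/allP => i; rewrite mem_iota /= => lt_i.
  apply/implyP => iz; have lt_i18 : (i < 18)%N by apply: leq_trans lt_i _.
  have := disjointFr dis (_ : Ordinal lt_i18 \in _).
  rewrite !inE => /(_ iz) /negbFE.
  by rewrite (@mul_systematic _ _ (Ordinal lt_i)) // bE mxE of4_eq0.
split; first by rewrite inE submxMl.
rewrite disjoint_subset; apply/subsetP => i; rewrite !inE => iz; rewrite negbK.
have lt_i : (i < 9)%N by move/allP: zs9; apply.
rewrite (@mul_systematic _ _ (Ordinal lt_i)) // mxE of4_eq0.
have sl := sch _ lC; move: lC; rewrite mem_shortened_choices // => /allP/(_ i).
by rewrite mem_iota iz => /(_ lt_i).
Qed.

End ShortenedWeights.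

(** * Harmonic functions of degree 3 *)

Section Harmonic.
Variables (R : realType) (n : nat).
Implicit Types (f : RX R n) (u y z : {set 'I_n}).

Lemma gammaE f y :
  gamma f y = \sum_(z : {set 'I_n} | (y \subset z) && (#|y|.+1 == #|z|)) f z.
Proof.
rewrite /gamma sum_ffunE [RHS]big_mkcond; apply: eq_bigr => z _.
rewrite ffunE sum_ffunE big_mkcond (bigD1 y) //= big1 => [|x xy].
  by case: ifP => _; rewrite ?ffunE ?eqxx addr0 ?scaler0 // /GRing.scale /= mulr1.
by case: ifP => // _; rewrite ffunE eq_sym (negbTE xy).
Qed.

Lemma sum_codim1_subsets (phi : {set 'I_n} -> R) z :
  \sum_(y : {set 'I_n} | (y \subset z) && (#|y|.+1 == #|z|)) phi y =
  \sum_(x in z) phi (z :\ x).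
Proof.
rewrite -(big_imset _ (h := fun x => z :\ x)) /=; last first.
  move=> a b az bz /= /setP/(_ b); rewrite !inE bz eqxx andbT /=.
  by move/negbFE/eqP.
apply: eq_bigl => y; apply/idP/imsetP => [/andP[yz /eqP cy] | [x xz ->]].
  have /cards1P[x zy] : #|z :\: y| == 1%N.
    by rewrite cardsD (setIidPr yz) -cy subSnn.
  have : x \in z :\: y by rewrite zy set11.
  rewrite inE => /andP[_ xz]; exists x => //.
  by rewrite -zy setDDr setDv set0U (setIidPr yz).
by rewrite subsetDl (cardsD1 x z) xz /=.
Qed.

(* Against a harmonic f of degree k + 1, every function of z that is a sum of
   contributions of the k-subsets of z integrates to 0. *)
Lemma harmonic_orthogonal k f (phi : {set 'I_n} -> R) : Harm k.+1 f ->
  \sum_(z : {set 'I_n} | #|z| == k.+1) f z * \sum_(x in z) phi (z :\ x) = 0.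
Proof.
move=> [_ gf].
under eq_bigr => z /eqP zk do rewrite -sum_codim1_subsets zk mulr_sumr.
rewrite (exchange_big_dep (fun y : {set 'I_n} => #|y| == k)) /=; last first.
  by move=> z y _ /andP[_]; rewrite eqSS.
apply: big1 => y /eqP yk; rewrite -mulr_suml.
have <- : gamma f y = \sum_(z : {set 'I_n} | (#|z| == k.+1) &&
    ((y \subset z) && (#|y|.+1 == k.+1))) f z.
  rewrite gammaE yk; apply: eq_bigl => z.
  by rewrite eqxx andbT andbC eq_sym.
by rewrite gf ffunE mul0r.
Qed.

(** Orthogonality with [phi] constant equal to 1: every [z] then has the weight k + 1, which is
    invertible in R. *)
Lemma harmonic_sum0 k f : Harm k.+1 f ->
  \sum_(z : {set 'I_n} | #|z| == k.+1) f z = 0.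
Proof.
move=> hf; apply: (mulIf (_ : k.+1%:R != 0 :> R)); first by rewrite pnatr_eq0.
rewrite mul0r mulr_suml -[RHS](harmonic_orthogonal (fun _ => 1) hf).
by apply: eq_bigr => z /eqP zk; rewrite sumr_const zk.
Qed.

(* For |z| = 3 the indicators of z \subset u and of z \subset ~: u add up to a
   sum over the pairs in z: among the three pairs either none or two meet both
   u and its complement. *)
Lemma tilde3_complement f u : Harm 3 f ->
  tilde 3 f u = - \sum_(z : {set 'I_n} | (#|z| == 3%N) && (z \subset ~: u)) f z.
Proof.
move=> hf; apply/eqP; rewrite -addr_eq0 /tilde; apply/eqP.
(* With value a on unmixed pairs and b on mixed ones, the requirements are 3 a = 1 when [z] lies on
   one side and a + 2 b = 0 otherwise. *)
pose phi y : R := if (y \subset u) || (y \subset ~: u) then 3^-1 else - 6^-1.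
rewrite -[RHS](harmonic_orthogonal phi hf) !big_mkcondr /= -big_split /=.
apply: eq_bigr => z z3.
have [a az] : exists a, a \in z by apply/card_gt0P; rewrite (eqP z3).
have /cards2P[b [c [bc zE]]] : #|z :\ a| == 2%N.
  by move: z3; rewrite (cardsD1 a z) az add1n.
have /setD1P[ba bz] : b \in z :\ a by rewrite zE !inE eqxx.
have /setD1P[ca cz] : c \in z :\ a by rewrite zE !inE eqxx orbT.
have zabc : z = [set a; b; c] by rewrite -setUA -zE setD1K.
have zb : z :\ b = [set a; c].
  rewrite zabc; apply/setP => x; rewrite !inE.
  by have [->|_] := eqVneq x b; rewrite /= ?(negbTE ba) ?(negbTE bc) ?orbF.
have zc : z :\ c = [set a; b].
  rewrite zabc; apply/setP => x; rewrite !inE.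
  by have [->|_] := eqVneq x c; rewrite /= ?(negbTE ca) 1?[c == b]eq_sym ?(negbTE bc) ?orbF.
rewrite (big_setD1 a az) /= zE (big_setU1 _ (_ : b \notin [set c])) ?inE //= big_set1.
rewrite zb zc zabc /phi !subUset !sub1set !inE.
by case: (a \in u); case: (b \in u); case: (c \in u); rewrite /=; lra.
Qed.

End Harmonic.

(** * Weight distributions of the shortened codes on the two orbits *)

Lemma sum_count_mem (V : nmodType) (psi : nat -> V) n s :
  all (fun w => w < n)%N s ->
  \sum_(w <- s) psi w = \sum_(w <- iota 0 n) psi w *+ count_mem w s.
Proof.
elim: s => [_|w s IH /= /andP[lt_w sn]].
  by rewrite big_nil big1.
rewrite big_cons IH //; under [RHS]eq_bigr do rewrite mulrnDr.
rewrite big_split /=; congr (_ + _).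
rewrite (bigD1_seq w) ?iota_uniq ?mem_iota //= eqxx big1 ?addr0 // => v vw.
by rewrite eq_sym (negbTE vw).
Qed.

Definition shortened_weights (zs : seq nat) (t : bool) : seq nat :=
  [seq count (predC1 zero4) l | l <- span (shortened_alphabets zs) (systematic_rows t)].

Definition weight_counts s : seq nat := [seq count_mem w s | w <- iota 0 19].

(** Entry [w] counts the words of weight [w], for [t] true, that vanish on a triple equivalent to
    {infinity, 0, 1}; the next list does so for {infinity, 0, 3}, whose last point is a nonresidue.
    Each list adds up to 4^6. *)
Definition counts_residue : seq nat :=
  [:: 1; 0; 0; 0; 0; 0; 81; 0; 72; 318; 855; 1008; 783; 630; 288; 60; 0; 0; 0]%N.

Definition counts_nonresidue : seq nat :=
  [:: 1; 0; 0; 0; 0; 0; 84; 0; 63; 354; 846; 882; 912; 630; 270; 54; 0; 0; 0]%N.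

(** Multiplication by the nonresidue 3 exchanges the two codes and also the two orbits of triples,
    which is why the distributions are swapped when [t] changes. *)
Lemma shortened_weights012 t (s := shortened_weights [:: 0; 1; 2]%N t) :
  all (fun w => w < 19)%N s /\
  weight_counts s = if t then counts_residue else counts_nonresidue.
Proof. by case: t @s; vm_compute. Qed.

Lemma shortened_weights013 t (s := shortened_weights [:: 0; 1; 3]%N t) :
  all (fun w => w < 19)%N s /\
  weight_counts s = if t then counts_nonresidue else counts_residue.
Proof. by case: t @s; vm_compute. Qed.

Lemma sum_weights_diff (V : comNzRingType) (psi : nat -> V) s s' :
  all (fun w => w < 19)%N s -> all (fun w => w < 19)%N s' ->
  weight_counts s = counts_residue -> weight_counts s' = counts_nonresidue ->
  \sum_(w <- s) psi w - \sum_(w <- s') psi w =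
  - (psi 6 *+ 3) + psi 8 *+ 9 - psi 9 *+ 36 + psi 10 *+ 9 + psi 11 *+ 126
  - psi 12 *+ 129 + psi 14 *+ 18 + psi 15 *+ 6.
Proof.
move=> s19 s19' cs cs'; rewrite (sum_count_mem _ s19) (sum_count_mem _ s19').
have sumE r c : weight_counts r = c ->
    \sum_(w <- iota 0 19) psi w *+ count_mem w r =
    \sum_(w <- iota 0 19) psi w *+ nth 0%N c w.
  move=> <-; apply: eq_big_seq => w; rewrite mem_iota /= => lt_w.
  by rewrite (nth_map 0%N) ?size_iota // nth_iota.
rewrite (sumE _ _ cs) (sumE _ _ cs') /= !big_cons !big_nil /=; ring.
Qed.

Theorem theorem4p3 (R : realType) (F : finFieldType) (hF : #|F| = 4%N)
    (L : fieldExtType F) (alpha : L) (halpha : 17.-primitive_root alpha)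
    (f : RX R 18) :
  let C : {set 'rV[F]_18} := extended_qr_code 17 alpha in
  let x := varx R in
  let y := vary R in
  Harm 3 f -> RX_invariant (code_Aut C) f ->
  exists c_f : R,
    harmonic_weight_enumerator 3 C f =
      c_f *: ( - (1224%:R * x ^+ 12 * y ^+ 6)
               + 3672%:R * x ^+ 10 * y ^+ 8
               - 14688%:R * x ^+ 9 * y ^+ 9
               + 3672%:R * x ^+ 8 * y ^+ 10
               + 51408%:R * x ^+ 7 * y ^+ 11
               - 52632%:R * x ^+ 6 * y ^+ 12
               + 7344%:R * x ^+ 4 * y ^+ 14
               + 2448%:R * x ^+ 3 * y ^+ 15).
Proof.
move=> C x y hf _.
have L2 : 2%:R = 0 :> L.
  by rewrite -(rmorph_nat (in_alg L)) (two_eq0_card4 hF) rmorph0.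
have [t qrE] := qr_poly_genpoly L2 halpha.
have CE : C = sys_code F t by exact: extended_qr_codeE.
pose mono w : {mpoly R[2]} := x ^+ (18 - w) * y ^+ w.
pose E (z : {set 'I_18}) := \sum_(c in C | [disjoint z & supp c]) mono (wt c).
have Einv tab (z : {set 'I_18}) : tab \in moebius_tables -> E (table_fun tab @: z) = E z.
  by rewrite /E CE; exact: shortened_sum_inv.
pose z1 := triple (0, 1, 2)%N; pose z2 := triple (0, 1, 3)%N.
(* The level set of [E] through [z1] replaces an orbit. Off this set [E] takes the value [E z2], by
   [invariant_two_values]. *)
pose S := \sum_(z : {set 'I_18} | (#|z| == 3%N) && (E z == E z1)) f z.
have wE : harmonic_weight_enumerator 3 C f = - (S *: (E z1 - E z2)).
  transitivity (- \sum_(z : {set 'I_18} | #|z| == 3%N) f z *: E z).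
    rewrite /harmonic_weight_enumerator.
    under eq_bigr do rewrite (tilde3_complement _ hf) scaleNr scaler_suml.
    rewrite sumrN; congr (- _).
    rewrite (exchange_big_dep (fun z : {set 'I_18} => #|z| == 3%N)) /=; last first.
      by move=> c z _ /andP[].
    apply: eq_bigr => z z3; rewrite scaler_sumr; apply: eq_bigl => c.
    by rewrite z3 disjoints_subset.
  (* As [f] sums to 0, its sum over the remaining 3-subsets is [- S]. *)
  congr (- _); have := harmonic_sum0 hf.
  rewrite (bigID (fun z => E z == E z1)) /= -/S => /eqP.
  rewrite addrC addr_eq0 => /eqP S'.
  rewrite (bigID (fun z => E z == E z1)) /= scalerBr -scaleNr -S'.
  rewrite /S !scaler_suml; congr (_ + _); apply: eq_bigr => z /andP[/eqP z3].
    by move/eqP ->.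
  by case: (invariant_two_values Einv z3) => ->; rewrite ?eqxx.
have Ez zs : all (fun i => i < 9)%N zs ->
    E [set i : 'I_18 | (i : nat) \in zs] = \sum_(w <- shortened_weights zs t) mono w.
  by move=> zs9; rewrite /E CE (shortened_sum hF t mono zs9) big_map.
have tripleE a b c : (a < 18)%N -> (b < 18)%N -> (c < 18)%N ->
    triple (a, b, c) = [set i : 'I_18 | (i : nat) \in [:: a; b; c]].
  move=> la lb lc; apply/setP => i; rewrite !inE -!val_eqE /= !inordK //.
  by rewrite orbA.
have [l1 c1] := shortened_weights012 t; have [l2 c2] := shortened_weights013 t.
have D := sum_weights_diff mono.
(* The coefficients are 408 times the differences of the two weight distributions. *)
have PE : forall c : R, c *: ( - (1224%:R * x ^+ 12 * y ^+ 6)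
               + 3672%:R * x ^+ 10 * y ^+ 8
               - 14688%:R * x ^+ 9 * y ^+ 9
               + 3672%:R * x ^+ 8 * y ^+ 10
               + 51408%:R * x ^+ 7 * y ^+ 11
               - 52632%:R * x ^+ 6 * y ^+ 12
               + 7344%:R * x ^+ 4 * y ^+ 14
               + 2448%:R * x ^+ 3 * y ^+ 15) =
   (c * 408%:R) *: (- (mono 6 *+ 3) + mono 8 *+ 9 - mono 9 *+ 36 + mono 10 *+ 9
     + mono 11 *+ 126 - mono 12 *+ 129 + mono 14 *+ 18 + mono 15 *+ 6).
  move=> c; rewrite -scalerA; congr (_ *: _); rewrite scaler_nat -mulr_natl /mono.
  ring.
have n408 : 408%:R != 0 :> R by rewrite pnatr_eq0.
(* The difference [E z1 - E z2] is the one in [sum_weights_diff] when [t] is true and its opposite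
   otherwise; hence the sign. *)
exists ((if t then - S else S) / 408%:R).
rewrite PE divfK // wE /z1 /z2 !tripleE // !Ez //.
case: (t) l1 c1 l2 c2 => l1 c1 l2 c2.
  by rewrite (D _ _ l1 l2 c1 c2) scaleNr.
by rewrite -scalerN opprB (D _ _ l2 l1 c2 c1).
Qed.
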